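(* Let $H$, $H_p$, $H_e$ and the time derivative $\frac{d}{dt}$ be as defined in the context. Whenever the horizons are defined (that is, whenever the integral defining the horizon in question converges), their evolution at redshift $z>-1$ is given by $$\frac{dH_p}{dt}=H_p(z)\,H(z)+1,\qquad\qquad \frac{dH_e}{dt}=H_e(z)\,H(z)-1 ,$$ the first formula holding whenever $H_p$ is defined and the second whenever $H_e$ is defined.
   Context: Units are $c=G=1$. The universe is a homogeneous and isotropic (Robertson-Walker) expanding universe with scale factor $a(t)$, $t$ being cosmic time, filled with countably many non-interacting constituents with state equations $p_i=w_i\rho_i$, $i\ge1$, where the $w_i$ are constant. Put $n_i=3(1+w_i)$ (arbitrary real constants). Let $H_0>0$ be the present value of the Hubble parameter $H=\frac1a\frac{da}{dt}$ and $\Omega_{i0}$ the present dimensionless energy density of the $i$-th constituent. The curvature is included as one of the constituents (with exponent $2$), so that $\sum_{i=1}^\infty\Omega_{i0}=1$. Finitely many state equations are covered by taking $\Omega_{i0}=0$ for all $i$ beyond some index. With redshift $z$ given by $1+z=a_0/a$ ($a_0$ the present scale factor), the Hubble parameter is $$H(z)=H_0\sqrt{\sum_{i=1}^\infty\Omega_{i0}(1+z)^{n_i}} .$$ Since the universe is expanding, $H$ is positive for $z>-1$. Standing hypothesis on $H$: with $S_n(z)=\sum_{i=1}^n\Omega_{i0}(1+z)^{n_i}$, the derivatives $S_n'$ converge uniformly to a function $G$ on $I=[-1,\infty)$, i.e. $\sup_{z\in I}|S_n'(z)-G(z)|\to0$ as $n\to\infty$. The particle horizon and the event horizon at redshift $z>-1$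 are $$H_p(z)=\frac1{1+z}\int_z^\infty\frac{dx}{H(x)},\qquad H_e(z)=\frac1{1+z}\int_{-1}^z\frac{dx}{H(x)}.$$ The products $H_p(z)H(z)$ and $H_e(z)H(z)$ are the recession velocities of the two horizons. Redshift and cosmic time are related by $\frac{dz}{dt}=-(1+z)H(z)$, so the time derivative of a function $X(z)$ is $\frac{dX}{dt}=-(1+z)H(z)X'(z)$. *)

(* Defs.v *)
(* Standard library reals with Coquelicot. *)
From Stdlib Require Import Reals.
From Coquelicot Require Import Coquelicot.
Open Scope R_scope.

(* Real power of a base x >= 0, with 0 ^ 0 = 1 and 0 ^ y = 0 for y <> 0.
   [Rpower] alone is not suitable at the base 0, since [Rpower 0 y = 1] for
   every y.  For a negative exponent the value at 0 is a convention. *)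
Definition rpow (x y : R) : R :=
  if Rlt_dec 0 x then Rpower x y
  else if Req_EM_T y 0 then 1 else 0.

(* The constituents are numbered from 0: [w i] and [Omega i] belong to the
   (i+1)-st constituent. *)
Definition expo (w : nat -> R) (i : nat) : R := 3 * (1 + w i).

Definition density_term (w Omega : nat -> R) (z : R) (i : nat) : R :=
  Omega i * rpow (1 + z) (expo w i).

(* [sum_n a n] is a 0 + ... + a n: the sum over the first n+1 constituents. *)
Definition density_sum (w Omega : nat -> R) (n : nat) (z : R) : R :=
  sum_n (density_term w Omega z) n.

Definition Hubble (H0 : R) (w Omega : nat -> R) (z : R) : R :=
  H0 * sqrt (Series (density_term w Omega z)).

Definition is_derive_on (D : R -> Prop) (f : R -> R) (z d : R) : Prop :=
  filterlim (fun y => (f y - f z) / (y - z)) (within D (locally' z)) (locally d).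

(* Uniform convergence on D of the derivatives of the f n, taken relative to D.
   The estimate concerns the pairs (n, z) for which f n is differentiable at z
   relative to D.  For D = [-1, oo) and f = [density_sum w Omega] these include
   all z > -1; at the endpoint -1 the one-sided derivative need not exist
   (it is infinite for (1 + z) ^ (1/2), for instance). *)
Definition derivatives_converge_uniformly
    (D : R -> Prop) (f : nat -> R -> R) (G : R -> R) : Prop :=
  forall eps : R, 0 < eps ->
    exists N : nat, forall n : nat, (N <= n)%nat ->
      forall z d : R, D z -> is_derive_on D (f n) z d -> Rabs (d - G z) <= eps.

Definition particle_horizon_defined (H : R -> R) (z : R) : Prop :=
  ex_RInt_gen (fun x => / H x) (at_point z) (Rbar_locally p_infty).

Definition particle_horizon (H : R -> R) (z : R) : R :=
  / (1 + z) * RInt_gen (fun x => / H x) (at_point z) (Rbar_locally p_infty).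

Definition event_horizon_defined (H : R -> R) (z : R) : Prop :=
  ex_RInt_gen (fun x => / H x) (at_right (-1)) (at_point z).

Definition event_horizon (H : R -> R) (z : R) : R :=
  / (1 + z) * RInt_gen (fun x => / H x) (at_right (-1)) (at_point z).

(* Derivative with respect to cosmic time t of a function X of the redshift,
   from the chain rule and dz/dt = - (1 + z) H(z).  [is_time_derive H X z v]
   includes the differentiability of X at z. *)
Definition is_time_derive (H X : R -> R) (z v : R) : Prop :=
  exists d : R, is_derive X z d /\ v = - (1 + z) * H z * d.

(* Main.v *)
Require Import Defs.
From Stdlib Require Import Reals Lra.
From Coquelicot Require Import Coquelicot.
Open Scope R_scope.

(** The partial sums of the density converge at [z = 0], and their derivatives
    are uniformly Cauchy.  By the mean value theorem the increments of
    [S_n - S_m] between two points [x], [y] are at most [eps * |y - x|] for large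
    [n], [m]; hence [S_n] converges pointwise on [z > -1] and its limit differs
    from some [S_N] by a Lipschitz function, so that [H] is continuous there.
    The rest is the fundamental theorem of calculus for the improper integrals
    and the product rule. *)

(** * Increments under uniformly convergent derivatives *)

(** Restricting the difference quotient to [D] keeps its limit. Ordinary derivatives may thus be fed
    into [derivatives_converge_uniformly]. *)
Lemma is_derive_is_derive_on (D : R -> Prop) (f : R -> R) (z d : R) :
  is_derive f z d -> is_derive_on D f z d.
Proof.
  intros Hf; apply is_derive_Reals in Hf.
  apply filterlim_locally; intros eps.
  destruct (Hf eps (cond_pos eps)) as [delta Hdelta].
  exists delta; intros y Hy Hne _.
  assert (E := Hdelta (y - z)).
  replace (z + (y - z)) with (y : R) in E by (simpl; lra).
  apply E; [intros E0; apply Hne; lra | exact Hy].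
Qed.

Lemma increments_uniformly_cauchy
    (D : R -> Prop) (f : nat -> R -> R) (G : R -> R) :
  derivatives_converge_uniformly D f G ->
  forall eps : R, 0 < eps ->
  exists N : nat, forall n m : nat, (N <= n)%nat -> (N <= m)%nat ->
  forall x y : R,
    (forall t, Rmin x y <= t <= Rmax x y -> D t /\ forall k, ex_derive (f k) t) ->
    Rabs ((f n y - f m y) - (f n x - f m x)) <= eps * Rabs (y - x).
Proof.
  intros HG eps Heps.
  destruct (HG (eps / 2)) as [N HN]; [lra|].
  exists N; intros n m Hn Hm x y Hxy.
  destruct (MVT_gen (fun t => f n t - f m t) x y
              (fun t => Derive (f n) t - Derive (f m) t)) as [c [Hc E]].
  - intros t Ht.
    destruct (Hxy t) as [_ Hd]; [lra|].
    apply (is_derive_minus (f n) (f m)); apply Derive_correct, Hd.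
  - intros t Ht.
    destruct (Hxy t Ht) as [_ Hd].
    apply continuity_pt_filterlim.
    apply (ex_derive_continuous (fun t => f n t - f m t)).
    apply (ex_derive_minus (f n) (f m)); apply Hd.
  - rewrite E, Rabs_mult.
    apply Rmult_le_compat_r; [apply Rabs_pos|].
    destruct (Hxy c Hc) as [Dc Hd].
    assert (Bn := HN n Hn c _ Dc
      (is_derive_is_derive_on D _ _ _ (Derive_correct _ _ (Hd n)))).
    assert (Bm := HN m Hm c _ Dc
      (is_derive_is_derive_on D _ _ _ (Derive_correct _ _ (Hd m)))).
    (* Both derivatives at [c] lie within [eps / 2] of [G c], which cancels in their difference. *)
    apply Rabs_le_between in Bn; apply Rabs_le_between in Bm.
    apply Rabs_le_between; lra.
Qed.

Lemma ex_derive_rpow (y x : R) : 0 < x -> ex_derive (fun u => rpow u y) x.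
Proof.
  intros Hx.
  apply ex_derive_ext_loc with (fun u => Rpower u y).
  - apply filter_imp with (2 := open_gt 0 x Hx).
    intros u Hu; unfold rpow.
    destruct (Rlt_dec 0 u); [reflexivity | contradiction].
  - eexists; apply is_derive_Reals, derivable_pt_lim_power, Hx.
Qed.

Lemma ex_derive_density_sum (w Omega : nat -> R) (n : nat) (z : R) :
  -1 < z -> ex_derive (density_sum w Omega n) z.
Proof.
  intros Hz.
  eexists; apply (is_derive_sum_n (fun k x => density_term w Omega x k)).
  intros k _; apply Derive_correct.
  apply (ex_derive_scal (fun x => rpow (1 + x) (expo w k)) (Omega k)).
  apply (ex_derive_comp (fun u => rpow u (expo w k)) (fun x => 1 + x)).
  - apply ex_derive_rpow; lra.
  - auto_derive; trivial.
Qed.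

(** At redshift 0 the base is 1, so the density series is that of [Omega]: this is the point where
    convergence is given. *)
Lemma density_term_0 (w Omega : nat -> R) (i : nat) :
  density_term w Omega 0 i = Omega i.
Proof.
  unfold density_term, rpow.
  destruct (Rlt_dec 0 (1 + 0)) as [_|H]; [|lra].
  rewrite Rplus_0_r; unfold Rpower; rewrite ln_1, Rmult_0_r, exp_0; ring.
Qed.

(** * Convergence and continuity of the density *)

Section Density.

Variables (w Omega : nat -> R) (G : R -> R).
Hypothesis Omega_sum : is_series Omega 1.
Hypothesis HG : derivatives_converge_uniformly
  (fun z => -1 <= z) (density_sum w Omega) G.

Lemma density_increments_cauchy (eps : R) :
  0 < eps ->
  exists N : nat, forall n m : nat, (N <= n)%nat -> (N <= m)%nat ->
  forall x y : R, -1 < x -> -1 < y ->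
    Rabs ((density_sum w Omega n y - density_sum w Omega m y)
          - (density_sum w Omega n x - density_sum w Omega m x))
    <= eps * Rabs (y - x).
Proof.
  intros Heps.
  destruct (increments_uniformly_cauchy _ _ _ HG eps Heps) as [N HN].
  exists N; intros n m Hn Hm x y Hx Hy.
  apply HN; trivial.
  (* The segment between [x] and [y] stays away from the endpoint -1, where a term may fail to be
     differentiable. *)
  intros t [Ht _].
  assert (-1 < t) by (apply Rlt_le_trans with (2 := Ht); now apply Rmin_glb_lt).
  split; [lra|]; intros k; now apply ex_derive_density_sum.
Qed.

(** [Series] is a total function, so convergence must be proved: the partial sums are Cauchy at 0,
    and the increments from 0 to [z] are uniformly Cauchy. *)
Lemma density_series_correct (z : R) :
  -1 < z ->
  is_lim_seq (fun n => density_sum w Omega n z) (Series (density_term w Omega z)).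
Proof.
  intros Hz.
  apply Lim_seq_correct', ex_lim_seq_cauchy_corr.
  intros eps.
  assert (C0 : ex_lim_seq_cauchy (fun n => density_sum w Omega n 0)).
  { apply ex_lim_seq_cauchy_corr; exists 1.
    apply is_series_ext with (2 := Omega_sum).
    intros i; symmetry; apply density_term_0. }
  assert (He2 : 0 < eps / 2) by (assert (H := cond_pos eps); lra).
  destruct (C0 (mkposreal _ He2)) as [N0 HN0].
  assert (Hpos : 0 < Rabs (z - 0) + 1) by (assert (H := Rabs_pos (z - 0)); lra).
  (* With this constant the increment over [0, z] is at most [eps / 2]; the added 1 keeps the
     divisor positive when [z] is 0. *)
  destruct (density_increments_cauchy (eps / 2 / (Rabs (z - 0) + 1)))
    as [N1 HN1]; [now apply Rdiv_lt_0_compat|].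
  exists (max N0 N1); intros n m Hn Hm.
  assert (B0 := HN0 n m (Nat.max_lub_l _ _ _ Hn) (Nat.max_lub_l _ _ _ Hm)).
  assert (B1 := HN1 n m (Nat.max_lub_r _ _ _ Hn) (Nat.max_lub_r _ _ _ Hm)
                  0 z ltac:(lra) Hz).
  assert (B2 : eps / 2 / (Rabs (z - 0) + 1) * Rabs (z - 0) <= eps / 2).
  { apply Rle_trans with (eps / 2 / (Rabs (z - 0) + 1) * (Rabs (z - 0) + 1)).
    - apply Rmult_le_compat_l; [apply Rlt_le; now apply Rdiv_lt_0_compat | lra].
    - right; field; lra. }
  simpl in B0.
  apply Rabs_lt_between in B0.
  apply (fun H => Rle_trans _ _ _ H B2), Rabs_le_between in B1.
  apply Rabs_lt_between; lra.
Qed.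

(** For a suitable [N], the limit minus the [N]-th partial sum is 1-Lipschitz on z > -1, and the
    partial sum itself is continuous. *)
Lemma continuous_density (z : R) :
  -1 < z -> continuous (fun x => Series (density_term w Omega x)) z.
Proof.
  intros Hz.
  destruct (density_increments_cauchy 1 Rlt_0_1) as [N HN].
  assert (B : forall y, -1 < y ->
    Rabs ((Series (density_term w Omega y) - density_sum w Omega N y)
          - (Series (density_term w Omega z) - density_sum w Omega N z))
    <= Rabs (y - z)).
  { intros y Hy.
    assert (L : is_lim_seq
      (fun n => Rabs ((density_sum w Omega n y - density_sum w Omega N y)
                      - (density_sum w Omega n z - density_sum w Omega N z)))
      (Rabs ((Series (density_term w Omega y) - density_sum w Omega N y)
          - (Series (density_term w Omega z) - density_sum w Omega N z)))).
    { apply (is_lim_seq_abs _ (Finite _)).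
      apply is_lim_seq_minus'; apply is_lim_seq_minus';
        try apply is_lim_seq_const; now apply density_series_correct. }
    (* Let [n] tend to infinity in the increment bound, with [N] as the second index. *)
    refine (is_lim_seq_le_loc _ _ _ _ _ L (is_lim_seq_const (Rabs (y - z)))).
    exists N; intros n Hn.
    rewrite <- (Rmult_1_l (Rabs (y - z))).
    now apply HN. }
  apply filterlim_locally; intros eps.
  assert (He2 : 0 < eps / 2) by (assert (H := cond_pos eps); lra).
  assert (C := ex_derive_continuous _ _ (ex_derive_density_sum w Omega N z Hz)).
  assert (C' := proj1 (filterlim_locally _ _) C (mkposreal _ He2)).
  refine (filter_imp _ _ _ (filter_and _ _ C'
           (filter_and _ _ (locally_ball z (mkposreal _ He2)) (open_gt (-1) z Hz)))).
  intros y [Hy1 [Hy2 Hy3]].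
  assert (By := B y Hy3).
  change (Rabs (density_sum w Omega N y - density_sum w Omega N z) < eps / 2) in Hy1.
  change (Rabs (y - z) < eps / 2) in Hy2.
  change (Rabs (Series (density_term w Omega y)
                - Series (density_term w Omega z)) < eps).
  apply Rabs_lt_between in Hy1.
  apply (fun H => Rle_lt_trans _ _ _ H Hy2), Rabs_lt_between in By.
  apply Rabs_lt_between; lra.
Qed.

End Density.

(** * Fundamental theorem of calculus for improper integrals *)

Lemma ex_RInt_near (f : R -> R) (z : R) :
  locally z (continuous f) -> locally z (fun y => ex_RInt f y z).
Proof.
  intros [d Hd]; exists d; intros y Hy.
  apply (ex_RInt_continuous (V := R_CompleteNormedModule)); intros t Ht.
  apply Hd.
  change (Rabs (y - z) < d) in Hy.
  change (Rabs (t - z) < d).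
  apply Rabs_lt_between in Hy; apply Rabs_lt_between.
  assert (H := cond_pos d).
  revert Ht; unfold Rmin, Rmax; destruct (Rle_dec y z); lra.
Qed.

(** By Chasles, convergence at [z] passes to every nearby [y], and the integral from [y] is a proper
    integral from [y] to [z] plus a constant. *)
Lemma is_derive_RInt_gen_lower (f : R -> R) (F : (R -> Prop) -> Prop)
    {FF : ProperFilter F} (z : R) :
  locally z (continuous f) ->
  ex_RInt_gen f (at_point z) F ->
  is_derive (fun y => RInt_gen f (at_point y) F) z (- f z).
Proof.
  intros Cf Hex.
  assert (HI := RInt_gen_correct f Hex).
  assert (Hnear := ex_RInt_near f z Cf).
  apply is_derive_ext_loc with (fun y => RInt f y z + RInt_gen f (at_point z) F).
  - apply filter_imp with (2 := Hnear); intros y Hy.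
    symmetry; apply is_RInt_gen_unique.
    apply (is_RInt_gen_Chasles f z); [|exact HI].
    apply is_RInt_gen_at_point, (RInt_correct f y z Hy).
  - replace (- f z) with (- f z + 0) by ring.
    apply (is_derive_plus (fun y => RInt f y z)
                          (fun _ => RInt_gen f (at_point z) F)).
    + apply (is_derive_RInt' f (fun y => RInt f y z) z z).
      * apply filter_imp with (2 := Hnear); intros y Hy.
        now apply (RInt_correct f y z).
      * exact (locally_singleton _ _ Cf).
    + apply @is_derive_const.
Qed.

Lemma is_derive_RInt_gen_upper (f : R -> R) (F : (R -> Prop) -> Prop)
    {FF : ProperFilter F} (z : R) :
  locally z (continuous f) ->
  ex_RInt_gen f F (at_point z) ->
  is_derive (fun y => RInt_gen f F (at_point y)) z (f z).
Proof.
  intros Cf Hex.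
  assert (HI := RInt_gen_correct f Hex).
  assert (Hnear := ex_RInt_near f z Cf).
  apply is_derive_ext_loc with (fun y => RInt_gen f F (at_point z) + RInt f z y).
  - apply filter_imp with (2 := Hnear); intros y Hy.
    symmetry; apply is_RInt_gen_unique.
    apply (is_RInt_gen_Chasles f z); [exact HI|].
    apply is_RInt_gen_at_point, (RInt_correct f z y), ex_RInt_swap, Hy.
  - replace (f z) with (0 + f z) by ring.
    apply (is_derive_plus (fun _ => RInt_gen f F (at_point z))
                          (fun y => RInt f z y)).
    + apply @is_derive_const.
    + apply (is_derive_RInt f (fun y => RInt f z y) z z).
      * apply filter_imp with (2 := Hnear); intros y Hy.
        now apply (RInt_correct f z y), ex_RInt_swap.
      * exact (locally_singleton _ _ Cf).
Qed.

(** * Evolution of the horizons *)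

(** Multiplied by [- (1 + z) * H z], the first summand becomes the horizon times [H z], and the
    second becomes [- H z * d], which is 1 or -1 for [d] equal to [- / H z] or [/ H z]. *)
Lemma is_derive_over_1_plus (J : R -> R) (z d : R) :
  -1 < z -> is_derive J z d ->
  is_derive (fun y => / (1 + y) * J y) z (- / (1 + z) ^ 2 * J z + / (1 + z) * d).
Proof.
  intros Hz HJ.
  apply (is_derive_mult (fun y => / (1 + y)) J); [|exact HJ|apply Rmult_comm].
  auto_derive; [lra | field; lra].
Qed.

Lemma continuous_inv_Hubble (H0 : R) (w Omega : nat -> R) (G : R -> R) :
  is_series Omega 1 ->
  (forall z : R, -1 < z -> 0 < Hubble H0 w Omega z) ->
  derivatives_converge_uniformly (fun z => -1 <= z) (density_sum w Omega) G ->
  forall z : R, -1 < z -> continuous (fun x => / Hubble H0 w Omega x) z.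
Proof.
  intros HO Hpos HG z Hz.
  apply continuous_Rinv_comp; [|apply Rgt_not_eq, Hpos, Hz].
  apply (continuous_scal_r H0 (fun x => sqrt (Series (density_term w Omega x)))).
  apply continuous_sqrt_comp, (continuous_density w Omega G HO HG z Hz).
Qed.

Theorem mainTheorem1 :
  forall (H0 : R) (w Omega : nat -> R) (G : R -> R),
    0 < H0 ->
    is_series Omega 1 ->
    (forall z : R, -1 < z -> 0 < Hubble H0 w Omega z) ->
    derivatives_converge_uniformly
      (fun z => -1 <= z) (density_sum w Omega) G ->
    forall z : R, -1 < z ->
      (particle_horizon_defined (Hubble H0 w Omega) z ->
       is_time_derive (Hubble H0 w Omega)
         (particle_horizon (Hubble H0 w Omega)) z
         (particle_horizon (Hubble H0 w Omega) z * Hubble H0 w Omega z + 1))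
      /\
      (event_horizon_defined (Hubble H0 w Omega) z ->
       is_time_derive (Hubble H0 w Omega)
         (event_horizon (Hubble H0 w Omega)) z
         (event_horizon (Hubble H0 w Omega) z * Hubble H0 w Omega z - 1)).
Proof.
  intros H0 w Omega G _ HO Hpos HG z Hz.
  assert (C : locally z (continuous (fun x => / Hubble H0 w Omega x))).
  (* The half-line z > -1 is open, so pointwise continuity there gives continuity on a neighbourhood
     of [z]. *)
  { apply filter_imp with (2 := open_gt (-1) z Hz).
    exact (continuous_inv_Hubble H0 w Omega G HO Hpos HG). }
  assert (Hz0 := Hpos z Hz).
  (* The derivative left open here is fixed by the product rule; what remains is an identity of
     fractions with [1 + z] and [H z] nonzero. *)
  split; intros Hdef; eexists; split.
  - apply is_derive_over_1_plus; [exact Hz|].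
    exact (is_derive_RInt_gen_lower _ (Rbar_locally p_infty) z C Hdef).
  - unfold particle_horizon; field; lra.
  - apply is_derive_over_1_plus; [exact Hz|].
    exact (is_derive_RInt_gen_upper _ (at_right (-1)) z C Hdef).
  - unfold event_horizon; field; lra.
Qed.
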